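(* Let $\mathfrak{g}$ be a nilpotent Lie algebra over the field $\mathbb{F}_2$, and let $n$ be a non-negative integer such that $\dim[\mathfrak{g},\mathfrak{g}] > n(n-1)/2$. Then there do not exist two proper Lie subalgebras $\mathfrak{h}_1,\mathfrak{h}_2$ of $\mathfrak{g}$, with $\mathfrak{h}_2$ of codimension at least $2$ in $\mathfrak{g}$, such that every element $x\in\mathfrak{g}$ with $b(x)\ge n$ lies in $\mathfrak{h}_1\cup\mathfrak{h}_2$.
   Context: For an element $x$ of a Lie algebra $\mathfrak{g}$ over a field, the centralizer is $C_{\mathfrak{g}}(x)=\{y\in\mathfrak{g} : [x,y]=0\}$, and the breadth of $x$ is $b(x)=\dim\mathfrak{g}-\dim C_{\mathfrak{g}}(x)$, i.e. the codimension of $C_{\mathfrak{g}}(x)$ in $\mathfrak{g}$ (a non-negative integer or $\infty$). $\mathfrak{g}'=[\mathfrak{g},\mathfrak{g}]$ denotes the derived subalgebra. *)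

(* Defs.v *)
(* Lie algebras over a field F, possibly infinite-dimensional:
   the underlying space is an arbitrary lmodType F, the bracket an explicit map. *)
From HB Require Import structures.
From mathcomp Require Import all_boot all_order all_algebra.
Set Implicit Arguments. Unset Strict Implicit. Unset Printing Implicit Defensive.
Import GRing.Theory.
Local Open Scope ring_scope.

Section LieDefs.
Variables (F : fieldType) (V : lmodType F).

Definition is_lie_bracket (br : V -> V -> V) : Prop :=
  [/\ (forall (a : F) x y z, br (a *: x + y) z = a *: br x z + br y z),
      (forall (a : F) x y z, br x (a *: y + z) = a *: br x y + br x z),
      (forall x, br x x = 0) &
      (forall x y z, br x (br y z) + br y (br z x) + br z (br x y) = 0)].

Definition span (S : V -> Prop) (v : V) : Prop :=
  exists (s : seq V) (c : 'I_(size s) -> F),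
    (forall i : 'I_(size s), S (nth 0 s i)) /\
    v = \sum_(i < size s) c i *: nth 0 s i.

Fixpoint lcs (br : V -> V -> V) (k : nat) : V -> Prop :=
  match k with
  | 0%N => fun _ => True
  | k'.+1 => span (fun v => exists x y, lcs br k' y /\ v = br x y)
  end.

Definition nilpotent (br : V -> V -> V) : Prop :=
  exists k, forall v, lcs br k v -> v = 0.

Definition derived (br : V -> V -> V) : V -> Prop :=
  span (fun v => exists x y, v = br x y).

Definition indep_mod (W : V -> Prop) (s : seq V) : Prop :=
  forall c : 'I_(size s) -> F,
    W (\sum_(i < size s) c i *: nth 0 s i) -> forall i, c i = 0.

Definition lin_indep (s : seq V) : Prop := indep_mod (fun v => v = 0) s.

Definition dim_gt (W : V -> Prop) (N : nat) : Prop :=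
  exists s : seq V, size s = N.+1 /\ (forall v, v \in s -> W v) /\ lin_indep s.

Definition codim_ge (W : V -> Prop) (d : nat) : Prop :=
  exists s : seq V, size s = d /\ indep_mod W s.

Definition centralizer (br : V -> V -> V) (x : V) : V -> Prop :=
  fun y => br x y = 0.

Definition breadth_ge (br : V -> V -> V) (x : V) (n : nat) : Prop :=
  codim_ge (centralizer br x) n.

Definition lie_subalgebra (br : V -> V -> V) (h : V -> Prop) : Prop :=
  [/\ h 0, (forall x y, h x -> h y -> h (x + y)),
      (forall (a : F) x, h x -> h (a *: x)) &
      (forall x y, h x -> h y -> h (br x y))].

Definition proper_subset (h : V -> Prop) : Prop := exists v, ~ h v.

End LieDefs.

(* Main.v *)
(* Consider the bracket as an alternating bilinear map taken modulo a subspace U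
   of its target, and argue by induction on n. Let X be the complement of h1 and
   h2, so that ranks are < n on X. Pick z in X that is not central mod U and put
   U' = U + [z,V]. The dimension of the span of the brackets drops by at most n - 1.
   If y in X keeps rank n - 1 modulo U', then [y,z] = 0 mod U, for otherwise z would
   raise the rank of y mod U to n; and y + z has the same rank as y mod U'. Over F_2,
   if neither y nor y + z is in X then y is in h2 + <z>. So the elements of rank
   >= n - 1 mod U' are covered by C(z) and h2 + <z>, which contradicts the induction
   hypothesis when z has rank >= 2. If instead all of X has rank <= 1, the whole
   space is the union of C(z), h2 + <z> and the centre mod U', which has
   codimension >= 2; that is impossible over F_2. *)
Require Import Defs.
From HB Require Import structures.
From mathcomp Require Import all_boot all_order all_algebra.
From Stdlib Require Import Classical.
From mathcomp Require Import zify.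

Set Implicit Arguments. Unset Strict Implicit. Unset Printing Implicit Defensive.
Import GRing.Theory.
Local Open Scope ring_scope.

(** * Linear algebra over F_2 modulo a subspace *)

Lemma F2_cases (a : 'F_2) : a = 0 \/ a = 1.
Proof.
by case: a => [[|[|k]] hk] //; [left|right]; apply: val_inj.
Qed.

Section F2Spaces.
Variable V : lmodType 'F_2.
Implicit Types (W D A B C : V -> Prop) (u v w : V) (k : nat).

Lemma addvv v : v + v = 0.
Proof.
by rewrite -(scale1r v) -scalerDl (_ : 1 + 1 = 0 :> 'F_2) ?scale0r //; apply: val_inj.
Qed.

Lemma addvK u v : u + v + v = u.
Proof. by rewrite -addrA addvv addr0. Qed.

(* Over F_2 additive subgroups are subspaces. *)
Definition subspace W : Prop := W 0 /\ forall u v, W u -> W v -> W (u + v).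

Lemma subspace_addr W u v : subspace W -> W v -> W (u + v) -> W u.
Proof. by move=> [_ WD] Wv Wuv; rewrite -(addvK u v); apply: WD. Qed.

Definition adjoin W w : V -> Prop := fun v => W v \/ W (v + w).

Lemma subspace_adjoin W w : subspace W -> subspace (adjoin W w).
Proof.
move=> [W0 WD]; split; first by left.
move=> u v [hu|hu] [hv|hv].
- by left; apply: WD.
- by right; rewrite -addrA; apply: WD.
- by right; rewrite addrAC; apply: WD.
- by left; move: (WD _ _ hu hv); rewrite addrACA addvv addr0.
Qed.

Lemma adjoin_mono W W' w : (forall v, W v -> W' v) ->
  forall v, adjoin W w v -> adjoin W' w v.
Proof. by move=> sWW' v [/sWW'|/sWW']; [left|right]. Qed.

(** Independent vectors of D modulo W are picked one at a time, so that dimension bounds make sense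
    in infinite dimension and are compared by induction on k. *)
Fixpoint dim_mod_ge D W k : Prop :=
  match k with
  | 0%N => True
  | k'.+1 => exists v, [/\ D v, ~ W v & dim_mod_ge D (adjoin W v) k']
  end.

Lemma dim_mod_ge_anti D W W' k : dim_mod_ge D W' k ->
  (forall v, W v -> W' v) -> dim_mod_ge D W k.
Proof.
elim: k W W' => [//|k IHk] W W' [v [Dv W'v hv]] sWW'.
exists v; split=> //; first by move/sWW'.
by apply: IHk hv _; apply: adjoin_mono.
Qed.

Lemma dim_mod_ge_leq D W k k' : (k <= k')%N -> dim_mod_ge D W k' -> dim_mod_ge D W k.
Proof.
elim: k k' W => [//|k IHk] [//|k'] W lekk' [v [Dv Wv hv]].
by exists v; split=> //; apply: IHk hv.
Qed.

(** An exchange argument: the first vector v picked is kept if it stays outside W + <w>; otherwise w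
    lies in W + <v>, and v is the one dropped. *)
Lemma dim_mod_ge_adjoin D W w k : subspace W ->
  dim_mod_ge D W k.+1 -> dim_mod_ge D (adjoin W w) k.
Proof.
elim: k W => [//|k IHk] W sW [v [Dv Wv hv]].
have hvw := IHk _ (subspace_adjoin v sW) hv.
case: (classic (adjoin W w v)) => [[//|Wvw]|nvw]; last first.
  exists v; split=> //; apply: dim_mod_ge_anti hvw _ => x [[h|h]|[h|h]].
  - by left; left.
  - by right; left.
  - by left; right.
  - by right; right; rewrite addrAC.
apply: (@dim_mod_ge_anti D _ (adjoin W v) k.+1) hv _ => x [h|h]; first by left.
right; have := sW.2 _ _ h Wvw.
by rewrite (addrC v) addrA addvK.
Qed.

(** The coefficient of v is 0 or 1, which matches the two cases of [adjoin]. *)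
Lemma indep_mod_cons W v s : subspace W ->
  indep_mod W (v :: s) <-> ~ W v /\ indep_mod (adjoin W v) s.
Proof.
move=> [W0 WD]; split=> [ind|[Wv ind]].
  have ext (a : 'F_2) (c : 'I_(size s) -> 'F_2) :
      W (a *: v + \sum_(i < size s) c i *: nth 0 s i) -> a = 0 /\ forall i, c i = 0.
    pose c' (i : 'I_(size (v :: s))) := if unlift ord0 i is Some j then c j else a.
    move=> h; have hc' i : c' i = 0.
      apply: ind; rewrite /= big_ord_recl /= /c' unlift_none.
      congr W: h; congr (_ + _); apply: eq_bigr => j _.
      by have /= -> := liftK (ord0 : 'I_(size s).+1) j.
    split; first by have := hc' ord0; rewrite /c' unlift_none.
    by move=> i; have := hc' (lift ord0 i); rewrite /c' liftK.
  split=> [Wv|c [h|h]].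
  - have /ext [/eqP] : W (1 *: v + \sum_(i < size s) (0 : 'F_2) *: nth 0 s i).
      by rewrite scale1r big1 ?addr0 // => i _; rewrite scale0r.
    by rewrite oner_eq0.
  - by have /ext [] : W (0 *: v + \sum_(i < size s) c i *: nth 0 s i);
      first by rewrite scale0r add0r.
  - by have /ext [] : W (1 *: v + \sum_(i < size s) c i *: nth 0 s i);
      first by rewrite scale1r addrC.
move=> c; rewrite /= big_ord_recl /= => h.
have c0 i : c (lift ord0 i) = 0.
  apply: (ind (fun j => c (lift ord0 j))).
  case: (F2_cases (c ord0)) h => ->; first by rewrite scale0r add0r; left.
  by rewrite scale1r addrC; right.
have cz : c ord0 = 0.
  case: (F2_cases (c ord0)) => // c1; case: Wv; move: h.
  by rewrite c1 scale1r big1 ?addr0 // => i _; rewrite c0 scale0r.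
by move=> i; case: (unliftP ord0 i) => [j|] ->.
Qed.

Lemma dim_mod_geP D W k : subspace W ->
  dim_mod_ge D W k <->
  exists s : seq V, [/\ size s = k, (forall v, v \in s -> D v) & indep_mod W s].
Proof.
elim: k W => [|k IHk] W sW.
  by split=> // _; exists [::]; split=> // c _ [].
split=> [[v [Dv Wv /(IHk _ (subspace_adjoin v sW)) [s [<- sD ind]]]]|].
  exists (v :: s); split=> //; last exact/indep_mod_cons.
  by move=> u; rewrite inE => /orP [/eqP ->|/sD].
case=> [[|v s] [//= [sz] sD /(indep_mod_cons v s sW) [Wv ind]]].
exists v; split=> //; first by apply: sD; rewrite mem_head.
apply/(IHk _ (subspace_adjoin v sW)); exists s; split=> // u us.
by apply: sD; rewrite inE us orbT.
Qed.

(** * Codimension, and coverings by two or three subspaces *)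

Definition codim_mod_ge W k : Prop := dim_mod_ge (fun _ => True) W k.

Lemma codim_mod_geP W k : subspace W -> codim_mod_ge W k <-> codim_ge W k.
Proof.
move=> sW; split=> [/(dim_mod_geP _ _ sW) [s [sz _ ind]]|[s [sz ind]]].
  by exists s.
by apply/(dim_mod_geP _ _ sW); exists s.
Qed.

Lemma proper_codim_mod_ge W : proper_subset W <-> codim_mod_ge W 1.
Proof. by split=> [[v Wv]|[v [_ Wv _]]]; exists v. Qed.

Lemma proper_cover2 B C : subspace B -> subspace C ->
  proper_subset B -> proper_subset C -> exists v, ~ B v /\ ~ C v.
Proof.
move=> sB sC [b Bb] [c Cc].
case: (classic (C b)) => Cb; last by exists b.
case: (classic (B c)) => Bc; last by exists c.
exists (b + c); split=> [h|]; first exact: Bb (subspace_addr sB Bc h).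
by rewrite addrC => h; apply: Cc (subspace_addr sC Cb h).
Qed.

Lemma proper_cover3 A B C : subspace A -> subspace B -> subspace C ->
  codim_mod_ge A 2 -> proper_subset B -> proper_subset C ->
  exists v, [/\ ~ A v, ~ B v & ~ C v].
Proof.
move=> sA sB sC A2 pB pC; apply: NNPP => none.
have cov v : ~ A v -> ~ B v -> C v.
  by move=> Av Bv; apply: NNPP => Cv; apply: none; exists v.
have pA : proper_subset A by apply/proper_codim_mod_ge; apply: dim_mod_ge_leq A2.
have [b [Ab Cb]] := proper_cover2 sA sC pA pC.
have Bb : B b by apply: NNPP => Bb; apply: none; exists b.
(* An element of C outside A and B is congruent to b mod A: its sum with b avoids B and C. *)
have eq_b v : ~ A v -> ~ B v -> A (v + b).
  move=> Av Bv; apply: NNPP => Avb; apply: none; exists (v + b); split=> // h.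
    exact: Bv (subspace_addr sB Bb h).
  by apply: Cb; move: h; rewrite addrC; apply: subspace_addr sC _; apply: cov.
(* As A has codimension at least 2, A + <b> is proper and does not cover V together with B; a vector
   missed by both contradicts [eq_b]. *)
have pAb : proper_subset (adjoin A b).
  by apply/proper_codim_mod_ge/dim_mod_ge_adjoin.
have [v [Abv Bv]] := proper_cover2 (subspace_adjoin b sA) sB pAb pB.
have Av : ~ A v by move=> h; apply: Abv; left.
by apply: Abv; right; apply: eq_b.
Qed.

End F2Spaces.

(** * The bracket modulo a subspace of its target *)

Section Bracket.
Variables (V : lmodType 'F_2) (br : V -> V -> V).
Hypothesis hLie : is_lie_bracket br.
Implicit Types (U W h : V -> Prop) (x y z : V).

Lemma brDl x y z : br (x + y) z = br x z + br y z.
Proof. by case: hLie => h _ _ _; have := h 1 x y z; rewrite !scale1r. Qed.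

Lemma brDr x y z : br x (y + z) = br x y + br x z.
Proof. by case: hLie => _ h _ _; have := h 1 x y z; rewrite !scale1r. Qed.

Lemma brxx x : br x x = 0.
Proof. by case: hLie. Qed.

Lemma br0r x : br x 0 = 0.
Proof. by rewrite -(addvv x) brDr !addvv. Qed.

Lemma br0l x : br 0 x = 0.
Proof. by rewrite -(addvv x) brDl !addvv. Qed.

Lemma brC x y : br x y = br y x.
Proof.
have := brxx (x + y); rewrite brDl !brDr !brxx add0r addr0 => h.
by rewrite -(addvK (br x y) (br y x)) h add0r.
Qed.

Definition cent_mod U x : V -> Prop := fun y => U (br x y).
(** Codimension of the kernel, hence rank, of the map [br x] from V to V/U; U = 0 gives the breadth
    of x. *)
Definition rank_ge U x k : Prop := codim_mod_ge (cent_mod U x) k.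
Definition center_mod U : V -> Prop := fun x => forall y, U (br x y).
(** The subspace U + [z,V], as signs vanish in characteristic 2. *)
Definition add_image U z : V -> Prop := fun v => exists y, U (v + br z y).

Lemma subspace_cent_mod U x : subspace U -> subspace (cent_mod U x).
Proof.
move=> [U0 UD]; split; rewrite /cent_mod ?br0r // => u v hu hv.
by rewrite brDr; apply: UD.
Qed.

Lemma subspace_center_mod U : subspace U -> subspace (center_mod U).
Proof.
move=> [U0 UD]; split=> [y|u v hu hv y]; first by rewrite br0l.
by rewrite brDl; apply: UD.
Qed.

Lemma subspace_add_image U z : subspace U -> subspace (add_image U z).
Proof.
move=> [U0 UD]; split; first by exists 0; rewrite br0r addr0.
move=> u v [y hy] [t ht]; exists (y + t).
by rewrite brDr addrACA; apply: UD.
Qed.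

Lemma add_image_br U z y : subspace U -> add_image U z (br z y).
Proof. by move=> [U0 _]; exists y; rewrite addvv. Qed.

(** Some bracket [a,b] lies outside U. Then a and b are independent modulo the centre: if b or a + b
    were central mod U, bracketing with a would put [a,b] in U. *)
Lemma center_mod_codim2 U : subspace U -> dim_mod_ge (derived br) U 1 ->
  codim_mod_ge (center_mod U) 2.
Proof.
move=> sU [d [[s [c [sbr ->]]] Ud _]].
have [a [b Uab]] : exists a b, ~ U (br a b).
  apply: NNPP => none; apply: Ud; case: (sU) => U0 UD.
  apply: (big_ind U) => // i _; case: (F2_cases (c i)) => ->; first by rewrite scale0r.
  rewrite scale1r; have [x [y ->]] := sbr i.
  by apply: NNPP => Uxy; apply: none; exists x, y.
exists a; split=> //.
exists b; split=> // -[/(_ a)|/(_ a)]; first by rewrite brC.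
by rewrite brDl brxx addr0 brC.
Qed.

(** Adding [z,V] costs at most the rank of z. Each step adjoins one vector of the image to U, which
    lowers both the bound on that rank and the dimension by one. *)
Lemma dim_mod_ge_add_image D U z m k : subspace U -> ~ rank_ge U z m.+1 ->
  dim_mod_ge D U (m + k) -> dim_mod_ge D (add_image U z) k.
Proof.
elim: m U => [|m IHm] U sU rk hD; last first.
  case: (classic (exists y, ~ U (br z y))) => [[y Uy]|none].
    have sW := subspace_adjoin (br z y) sU.
    have rkW : ~ rank_ge (adjoin U (br z y)) z m.+1.
      move=> rkW; apply: rk; exists y; split=> //.
      apply: dim_mod_ge_anti rkW _ => v; rewrite /adjoin /cent_mod brDr.
      by case; [left|right].
    apply: dim_mod_ge_anti (IHm _ sW rkW (dim_mod_ge_adjoin _ sU hD)) _ => v [t ht].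
    by exists t; left.
  apply: dim_mod_ge_anti (dim_mod_ge_leq (leq_addl _ _) hD) _ => v [t ht].
  apply: (subspace_addr sU _ ht); apply: NNPP => Ut; apply: none.
  by exists t.
apply: dim_mod_ge_anti hD _ => v [t ht].
apply: (subspace_addr sU _ ht); apply: NNPP => Ut; apply: rk.
by exists t.
Qed.

(** The vector [y,z] vanishes modulo [add_image U z]; if it were nonzero modulo U, it would add one
    to the rank of y. *)
Lemma cent_mod_of_rank_add_image U z y m : subspace U ->
  rank_ge (add_image U z) y m -> ~ rank_ge U y m.+1 -> U (br z y).
Proof.
move=> sU rk' rk; apply: NNPP => Uzy; apply: rk; exists z.
split=> //; first by rewrite /cent_mod brC.
apply: dim_mod_ge_anti rk' _ => v [h|h]; rewrite /cent_mod in h *.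
  by exists 0; rewrite br0r addr0.
by exists y; rewrite (brC z) -brDr.
Qed.

Lemma rank_ge_add_image_shift U z y m : subspace U ->
  rank_ge (add_image U z) y m -> rank_ge (add_image U z) (y + z) m.
Proof.
move=> sU rk; apply: dim_mod_ge_anti rk _ => v; rewrite /cent_mod brDl.
apply: subspace_addr; first exact: subspace_add_image.
exact: add_image_br.
Qed.

(** As z is outside h1, at most one of y and y + z is in h1; when neither is in h2, one of them has
    rank at most m mod U, and both have the same bracket with z. *)
Lemma rank_add_image_cover U h1 h2 z y m : subspace U -> subspace h1 ->
  (forall x, ~ h1 x -> ~ h2 x -> ~ rank_ge U x m.+1) -> ~ h1 z ->
  rank_ge (add_image U z) y m -> adjoin h2 z y \/ cent_mod U z y.
Proof.
move=> sU sh1 low h1z rk.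
case: (classic (h2 y)) => h2y; first by left; left.
case: (classic (h2 (y + z))) => h2yz; first by left; right.
right; case: (classic (h1 y)) => h1y; last first.
  exact: cent_mod_of_rank_add_image sU rk (low _ h1y h2y).
have h1yz : ~ h1 (y + z).
  by rewrite addrC => h; apply: h1z (subspace_addr sh1 h1y h).
have := cent_mod_of_rank_add_image sU (rank_ge_add_image_shift sU rk) (low _ h1yz h2yz).
by rewrite brDr brxx addr0.
Qed.

(** * The induction on n *)

Lemma rank_ge_not_covered n U h1 h2 :
  subspace U -> subspace h1 -> subspace h2 ->
  dim_mod_ge (derived br) U ((n * (n - 1)) %/ 2).+1 ->
  proper_subset h1 -> codim_mod_ge h2 2 ->
  ~ forall x, rank_ge U x n -> h1 x \/ h2 x.
Proof.
elim: n U h1 h2 => [|m IHm] U h1 h2 sU sh1 sh2 hD ph1 ch2 cov.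
  (* For n = 0 every vector has rank at least n, so h1 and h2 would cover V. *)
  have ph2 : proper_subset h2 by apply/proper_codim_mod_ge; apply: dim_mod_ge_leq ch2.
  by have [v [h1v h2v]] := proper_cover2 sh1 sh2 ph1 ph2; case: (cov v I).
have low x : ~ h1 x -> ~ h2 x -> ~ rank_ge U x m.+1 by move=> ? ? /cov [].
have proper_adj z : proper_subset (adjoin h2 z).
  by apply/proper_codim_mod_ge/dim_mod_ge_adjoin.
case: (classic (exists z, [/\ ~ h1 z, ~ h2 z & rank_ge U z 2])) => [[z [h1z h2z rk2]]|none].
  (* The proper subspace h2 + <z> now plays the role of h1, and C(z) mod U, of codimension at least
     2 by [rk2], that of h2. *)
  apply: (IHm (add_image U z) (adjoin h2 z) (cent_mod U z)) => //.
  - exact: subspace_add_image.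
  - exact: subspace_adjoin.
  - exact: subspace_cent_mod.
  - apply: (dim_mod_ge_add_image sU (low z h1z h2z)).
    apply: dim_mod_ge_leq hD.
    have : (m * (m - 1) %/ 2 + m = m.+1 * (m.+1 - 1) %/ 2)%N.
      have -> : (m.+1 * (m.+1 - 1) = m * 2 + m * (m - 1))%N by nia.
      by rewrite divnMDl // addnC.
    lia.
  by move=> y; apply: (rank_add_image_cover sU sh1 low).
have low1 x : ~ h1 x -> ~ h2 x -> ~ rank_ge U x 2.
  by move=> h1x h2x rkx; apply: none; exists x.
have ph2 : proper_subset h2 by apply/proper_codim_mod_ge; apply: dim_mod_ge_leq ch2.
have cZ := center_mod_codim2 sU (dim_mod_ge_leq (ltn0Sn _) hD).
have [z [Zz h1z h2z]] := proper_cover3 (subspace_center_mod sU) sh1 sh2 cZ ph1 ph2.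
have pC : proper_subset (cent_mod U z).
  by apply: NNPP => none'; apply: Zz => y; apply: NNPP => Uy; apply: none'; exists y.
(* For m = 0 the noncentral z would already have the forbidden rank 1. Hence m(m+1)/2 + 1 is at
   least 2, and adding [z,V], of dimension at most 1 mod U, leaves some bracket nonzero. *)
have m_gt0 : (0 < m)%N.
  rewrite lt0n; apply/eqP => m0; move: (low z h1z h2z); rewrite m0.
  by move/proper_codim_mod_ge: pC.
have hD' : dim_mod_ge (derived br) (add_image U z) 1.
  apply: (dim_mod_ge_add_image sU (low1 z h1z h2z)).
  apply: dim_mod_ge_leq hD; rewrite ltnS divn_gt0 //; nia.
have sU' := subspace_add_image z sU.
have [y [Zy hy Cy]] := proper_cover3 (subspace_center_mod sU') (subspace_adjoin z sh2)
  (subspace_cent_mod z sU) (center_mod_codim2 sU' hD') (proper_adj z) pC.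
(* Not being central mod U + [z,V], y has rank at least 1 there, so the covering lemma puts it in
   one of the subspaces it avoids. *)
have rky : rank_ge (add_image U z) y 1.
  apply/proper_codim_mod_ge; apply: NNPP => none'; apply: Zy => v.
  by apply: NNPP => Uv; apply: none'; exists v.
by case: (rank_add_image_cover sU sh1 low1 h1z rky).
Qed.

End Bracket.

Lemma lie_subalgebra_subspace (V : lmodType 'F_2) (br : V -> V -> V) (h : V -> Prop) :
  lie_subalgebra br h -> subspace h.
Proof. by case. Qed.

Theorem theorem1p3 (V : lmodType 'F_2) (br : V -> V -> V)
  (hLie : is_lie_bracket br) (hnil : nilpotent br) (n : nat)
  (hdim : dim_gt (derived br) ((n * (n - 1)) %/ 2)) :
  ~ exists h1 h2 : V -> Prop,
      [/\ lie_subalgebra br h1 /\ proper_subset h1,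
          lie_subalgebra br h2 /\ proper_subset h2,
          codim_ge h2 2 &
          forall x : V, breadth_ge br x n -> h1 x \/ h2 x].
Proof.
case=> h1 [h2 [[sub1 p1] [sub2 _] c2 cov]].
have s0 : subspace (fun v : V => v = 0) by split=> // u v -> ->; rewrite addr0.
have sh2 := lie_subalgebra_subspace sub2.
apply: (@rank_ge_not_covered V br hLie n (fun v => v = 0) h1 h2) => //.
- exact: lie_subalgebra_subspace sub1.
- by apply/(dim_mod_geP _ _ s0); case: hdim => s [sz [sD ind]]; exists s.
- exact/(codim_mod_geP _ sh2).
move=> x /(codim_mod_geP _ (subspace_cent_mod hLie x s0)).
exact: cov.
Qed.
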